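(* Consider the inconsistent-read asynchronous iteration defined in the context with step size $0\le\beta<1$, an arbitrary deterministic starting vector $x_0$, a nonnegative integer $\tau$, and deterministic sets $K(j)$ satisfying $\{i\in\mathbb{Z}:0\le i\le j-\tau-1\}\subseteq K(j)\subseteq\{0,\dots,j-1\}$. Let $\rho_2=\max_l\frac1n\sum_{r=1}^nA_{lr}^2$ and $\omega_\tau(\beta)=2\beta(1-\beta-\rho_2\tau^2\beta/2)$, and suppose $\omega_\tau(\beta)>0$. Then: (a) For every integer $m\ge \frac{\log(1/2)}{\log(1-\lambda_{\max}/n)}$, \[E_m\le\Big(1-\frac{\omega_\tau(\beta)}{2\kappa}\Big)E_0.\] (b) Let $T_0=\big\lceil \frac{\log(1/2)}{\log(1-\lambda_{\max}/n)}\big\rceil$, $T=T_0+\tau$, and \[\psi(\beta)=\frac{\rho_2\tau^3\beta^2\lambda_{\max}(1-\lambda_{\max}/n)^{-2\tau}}{n}.\] Then for every integer $r\ge1$ and every $m\ge rT$, \[E_m\le\Big(1-\frac{\omega_\tau(\beta)}{2\kappa}\Big)\Big(1-\frac{\omega_\tau(\beta)(1-\lambda_{\max}/n)^{\tau}}{2\kappa}+\psi(\beta)\Big)^{r-1}E_0.\]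
   Context: Let $n\ge2$ and let $A\in\mathbb{R}^{n\times n}$ be symmetric positive definite with all diagonal entries equal to $1$; let $b\in\mathbb{R}^n$ and $x^\star=A^{-1}b$. Let $\lambda_{\min},\lambda_{\max}$ be the smallest and largest eigenvalues of $A$ and $\kappa=\lambda_{\max}/\lambda_{\min}$. Write $(x,y)_A=y^TAx$ and $\|x\|_A=\sqrt{(x,x)_A}$; $e^{(1)},\dots,e^{(n)}$ are the standard basis vectors. Inconsistent-read iteration: let $d_0,d_1,\dots$ be i.i.d. random vectors, each uniformly distributed on $\{e^{(1)},\dots,e^{(n)}\}$; let $\tau\ge0$ be an integer and $K(0),K(1),\dots$ deterministic sets (not depending on the $d_j$) with $\{i:0\le i\le j-\tau-1\}\subseteq K(j)\subseteq\{0,\dots,j-1\}$; given $x_0\in\mathbb{R}^n$ and a step size $\beta$, define recursively for $j\ge0$ \[x_{K(j)}=x_0+\sum_{i\in K(j)}\beta\gamma_id_i,\qquad \gamma_j=(x^\star-x_{K(j)},d_j)_A,\qquad x_{j+1}=x_j+\beta\gamma_jd_j.\] Define $E_m=\mathbb{E}[\|x_m-x^\star\|_A^2]$. *)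

(* Defs.v *)
(* classical reals. Vectors are nat -> R (indices 0..n-1),
   matrices are nat -> nat -> R. *)
From Stdlib Require Import Reals List.
Import ListNotations.
Open Scope R_scope.

Fixpoint sumR (n : nat) (f : nat -> R) : R :=
  match n with O => 0 | S k => sumR k f + f k end.

Fixpoint maxR (n : nat) (f : nat -> R) : R :=
  match n with O => 0 | S O => f O | S k => Rmax (maxR k f) (f k) end.

Definition unitv (k : nat) : nat -> R := fun c => if Nat.eqb k c then 1 else 0.

Definition Ainner (n : nat) (A : nat -> nat -> R) (x y : nat -> R) : R :=
  sumR n (fun r => sumR n (fun c => y r * A r c * x c)).

Definition Anorm2 (n : nat) (A : nat -> nat -> R) (x : nat -> R) : R :=
  Ainner n A x x.

Definition is_eigenvalue (n : nat) (A : nat -> nat -> R) (lam : R) : Prop :=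
  exists v : nat -> R, (exists i, (i < n)%nat /\ v i <> 0) /\
    forall i, (i < n)%nat -> sumR n (fun j => A i j * v j) = lam * v i.

Definition is_max_eigenvalue n A lam : Prop :=
  is_eigenvalue n A lam /\ forall mu, is_eigenvalue n A mu -> mu <= lam.
Definition is_min_eigenvalue n A lam : Prop :=
  is_eigenvalue n A lam /\ forall mu, is_eigenvalue n A mu -> lam <= mu.

(* The inconsistent-read iteration, for a fixed realisation of the directions:
   d : nat -> nat, with d_j = e^{(d j)}.  K j i = true iff i \in K(j). *)
Section Iter.
Variables (n : nat) (A : nat -> nat -> R) (xs x0 : nat -> R) (beta : R)
          (K : nat -> nat -> bool) (d : nat -> nat).

(* x_{K(j)} given the already computed gammas g = [gamma_0; ...; gamma_{j-1}] *)
Definition xK (g : list R) (j : nat) : nat -> R :=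
  fun c => x0 c + sumR j (fun i => if K j i then beta * nth i g 0 * unitv (d i) c else 0).

Fixpoint gammas (j : nat) : list R :=
  match j with
  | O => []
  | S j' => let g := gammas j' in
            g ++ [Ainner n A (fun c => xs c - xK g j' c) (unitv (d j'))]
  end.

Definition xiter (m : nat) : nat -> R :=
  fun c => x0 c + sumR m (fun i => beta * nth i (gammas m) 0 * unitv (d i) c).
End Iter.

(* Expectation over d_0, ..., d_{m-1} i.i.d. uniform on {0,...,n-1}. *)
Fixpoint avg (n m : nat) (F : (nat -> nat) -> R) : R :=
  match m with
  | O => F (fun _ => O)
  | S m' => sumR n (fun k => avg n m' (fun d => F (fun i => if Nat.eqb i m' then k else d i)))
            / INR n
  end.

Definition Eerr n A xs x0 beta K (m : nat) : R :=
  avg n m (fun d => Anorm2 n A (fun c => xiter n A xs x0 beta K d m c - xs c)).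

Definition rho2 (n : nat) (A : nat -> nat -> R) : R :=
  maxR n (fun l => / INR n * sumR n (fun r => (A l r)^2)).

Definition omega (rho tau beta : R) : R :=
  2 * beta * (1 - beta - rho * tau^2 * beta / 2).

(* Main.v *)
(* Summing the one-step energy inequality with the Lyapunov function L = E + (charges of past
   reads still to be paid) gives L_{s+k} <= L_s - w * (sum of E[gamma_j^2] over s <= j < s+k), and
   these second moments are bounded below because an update never shrinks the expected energy of
   a partial iterate below 1 - lmax/n times its value.  This yields (a), and for (b) a contraction of L by
   1 - a + psi per block, where a is the guaranteed decrease, as soon as (a - psi) * (L_s - E_s)
   <= psi * E_s.  That is trivial when psi >= a; otherwise beta * sqrt(rho2) * tau *
   (1 - lmax/n)^(-tau/2) < 1, so that delays inflate E[gamma_j^2] by a bounded factor only. *)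

Require Import Defs.
From Stdlib Require Import Reals List Lra Lia Classical FunctionalExtensionality.
Open Scope R_scope.

(** * Finite sums *)

(** The obstacle is that gamma_j is computed at x_{K(j)}, which need not be an iterate. For a fixed
    index set J, let a process apply only the updates in J, with the gammas of the actual iteration.
    Whatever those gammas are, its mean energy keeps at least the fraction 1 - lmax/n in each step,
    and for J = K(j) it coincides with the true iterates up to time j - tau. This bounds
    E[gamma_j^2] below by an earlier energy. At time 0 all these processes are at x0 and no charge
    is pending, so (a) contains neither a power of 1 - lmax/n nor psi. In a later block the first
    tau reads may miss updates made before its start s. Dropping them costs the summand tau in T and
    the factor (1 - lmax/n)^tau in a, and the decrease is a E_s, not a L_s. Since L_s - a E_s = (1 -
    a) L_s + a (L_s - E_s), the rate 1 - a + psi needs a (L_s - E_s) <= psi L_s, which is the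
    condition of the overview. It calls for an upper bound on E[gamma_j^2] as well. *)

Lemma sumR_ext n f g : (forall i, (i < n)%nat -> f i = g i) -> sumR n f = sumR n g.
Proof.
  induction n as [|n IH]; intros H; simpl; [reflexivity|].
  rewrite IH, H; auto.
Qed.

Lemma sumR_le n f g : (forall i, (i < n)%nat -> f i <= g i) -> sumR n f <= sumR n g.
Proof.
  induction n as [|n IH]; intros H; simpl; [lra|].
  apply Rplus_le_compat; auto.
Qed.

Lemma sumR_0 n : sumR n (fun _ => 0) = 0.
Proof. induction n as [|n IH]; simpl; [reflexivity|lra]. Qed.

Lemma sumR_nonneg n f : (forall i, (i < n)%nat -> 0 <= f i) -> 0 <= sumR n f.
Proof. intros H; rewrite <- (sumR_0 n); now apply sumR_le. Qed.

Lemma sumR_plus n f g : sumR n (fun i => f i + g i) = sumR n f + sumR n g.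
Proof. induction n as [|n IH]; simpl; [lra|rewrite IH; lra]. Qed.

Lemma sumR_scal n a f : sumR n (fun i => a * f i) = a * sumR n f.
Proof. induction n as [|n IH]; simpl; [lra|rewrite IH; lra]. Qed.

Lemma sumR_const n a : sumR n (fun _ => a) = INR n * a.
Proof. induction n as [|n IH]; [simpl; lra|]. rewrite S_INR; simpl; rewrite IH; lra. Qed.

Lemma sumR_swap n m (f : nat -> nat -> R) :
  sumR n (fun i => sumR m (fun j => f i j)) = sumR m (fun j => sumR n (fun i => f i j)).
Proof.
  induction n as [|n IH]; simpl; [now rewrite sumR_0|].
  now rewrite IH, sumR_plus.
Qed.

Lemma sumR_term_le n f k :
  (forall i, (i < n)%nat -> 0 <= f i) -> (k < n)%nat -> f k <= sumR n f.
Proof.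
  induction n as [|n IH]; intros H Hk; [lia|simpl].
  assert (0 <= f n) by (apply H; lia).
  destruct (Nat.eq_dec k n) as [->|].
  - assert (0 <= sumR n f) by (apply sumR_nonneg; intros; apply H; lia). lra.
  - assert (f k <= sumR n f) by (apply IH; [intros; apply H|]; lia). lra.
Qed.

Lemma sumR_add n m f : sumR (n + m) f = sumR n f + sumR m (fun i => f (n + i)%nat).
Proof.
  induction m as [|m IH]; [rewrite Nat.add_0_r; simpl; lra|].
  rewrite Nat.add_succ_r; simpl; rewrite IH; lra.
Qed.

Lemma unitv_same k : unitv k k = 1.
Proof. unfold unitv; now rewrite Nat.eqb_refl. Qed.

Lemma unitv_diff k i : k <> i -> unitv k i = 0.
Proof. intros H; unfold unitv; now rewrite (proj2 (Nat.eqb_neq _ _) H). Qed.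

Lemma sumR_unitv n k f : (k < n)%nat -> sumR n (fun i => unitv k i * f i) = f k.
Proof.
  induction n as [|n IH]; intros Hk; [lia|simpl].
  destruct (Nat.eq_dec k n) as [->|Hn].
  - rewrite unitv_same, (sumR_ext n _ (fun _ => 0)), sumR_0; [lra|].
    intros i Hi; rewrite unitv_diff by lia; lra.
  - rewrite IH, unitv_diff by lia; lra.
Qed.

Lemma sumR_cauchy n f g :
  (sumR n (fun i => f i * g i))^2 <= sumR n (fun i => (f i)^2) * sumR n (fun i => (g i)^2).
Proof.
  induction n as [|n IH]; cbn [sumR]; [lra|].
  assert (HF : 0 <= sumR n (fun i => (f i)^2)) by (apply sumR_nonneg; intros; nra).
  assert (HG : 0 <= sumR n (fun i => (g i)^2)) by (apply sumR_nonneg; intros; nra).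
  set (F := sumR n (fun i => (f i)^2)) in *.
  set (G := sumR n (fun i => (g i)^2)) in *.
  set (S := sumR n (fun i => f i * g i)) in *.
  set (a := f n); set (b := g n).
  assert (H : 2 * S * (a * b) <= F * b^2 + a^2 * G).
  { assert (Hab : (2 * S * (a * b))^2 <= (F * b^2 + a^2 * G)^2).
    { assert (S^2 * (a*b)^2 <= F * G * (a*b)^2) by (apply Rmult_le_compat_r; nra).
      assert (0 <= (F * b^2 - a^2 * G)^2) by apply pow2_ge_0. nra. }
    assert (0 <= F * b^2 + a^2 * G) by (apply Rplus_le_le_0_compat; apply Rmult_le_pos; nra).
    nra. }
  nra.
Qed.

(** * Quadratic forms *)

Definition mulv (n : nat) (A : nat -> nat -> R) (x : nat -> R) (r : nat) : R :=
  sumR n (fun c => A r c * x c).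

Definition dot (n : nat) (x y : nat -> R) : R := sumR n (fun i => x i * y i).

Definition sym (n : nat) (A : nat -> nat -> R) : Prop :=
  forall i j, (i < n)%nat -> (j < n)%nat -> A i j = A j i.

Definition posdef (n : nat) (A : nat -> nat -> R) : Prop :=
  forall x : nat -> R, (exists i, (i < n)%nat /\ x i <> 0) -> Ainner n A x x > 0.

Lemma Ainner_dot n A x y : Ainner n A x y = dot n y (mulv n A x).
Proof.
  unfold Ainner, dot, mulv; apply sumR_ext; intros r _.
  rewrite <- sumR_scal; apply sumR_ext; intros; lra.
Qed.

Lemma dot_comm n x y : dot n x y = dot n y x.
Proof. apply sumR_ext; intros; lra. Qed.

Lemma dot_plus_r n x y z : dot n x (fun i => y i + z i) = dot n x y + dot n x z.
Proof. unfold dot; rewrite <- sumR_plus; apply sumR_ext; intros; lra. Qed.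

Lemma dot_scal_r n a x y : dot n x (fun i => a * y i) = a * dot n x y.
Proof. unfold dot; rewrite <- sumR_scal; apply sumR_ext; intros; lra. Qed.

Lemma dot_ext n x x' y y' :
  (forall i, (i < n)%nat -> x i = x' i) -> (forall i, (i < n)%nat -> y i = y' i) ->
  dot n x y = dot n x' y'.
Proof. intros Hx Hy; apply sumR_ext; intros; now rewrite Hx, Hy. Qed.

Lemma dot_nonneg n x : 0 <= dot n x x.
Proof. apply sumR_nonneg; intros; nra. Qed.

Lemma dot_pos n x i : (i < n)%nat -> x i <> 0 -> 0 < dot n x x.
Proof.
  intros Hi Hx; apply Rlt_le_trans with (x i * x i); [nra|].
  apply (sumR_term_le n (fun i => x i * x i)); [intros; nra|assumption].
Qed.

Lemma mulv_ext n A x y r :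
  (forall i, (i < n)%nat -> x i = y i) -> mulv n A x r = mulv n A y r.
Proof. intros H; apply sumR_ext; intros; now rewrite H. Qed.

Lemma mulv_plus n A x y r : mulv n A (fun i => x i + y i) r = mulv n A x r + mulv n A y r.
Proof. unfold mulv; rewrite <- sumR_plus; apply sumR_ext; intros; lra. Qed.

Lemma mulv_scal n A a x r : mulv n A (fun i => a * x i) r = a * mulv n A x r.
Proof. unfold mulv; rewrite <- sumR_scal; apply sumR_ext; intros; lra. Qed.

Lemma mulv_unitv n A k r : (k < n)%nat -> mulv n A (unitv k) r = A r k.
Proof.
  intros Hk; unfold mulv; rewrite <- (sumR_unitv n k (fun c => A r c)) by assumption.
  apply sumR_ext; intros; lra.
Qed.

Lemma dot_unitv n k x : (k < n)%nat -> dot n (unitv k) x = x k.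
Proof. intros Hk; now apply sumR_unitv. Qed.

Lemma dot_mulv_sym n A x y : sym n A -> dot n x (mulv n A y) = dot n y (mulv n A x).
Proof.
  intros HA; unfold dot, mulv.
  rewrite (sumR_ext n _ (fun i => sumR n (fun j => x i * A i j * y j)))
    by (intros; rewrite <- sumR_scal; apply sumR_ext; intros; lra).
  rewrite sumR_swap; apply sumR_ext; intros i Hi.
  rewrite <- sumR_scal; apply sumR_ext; intros j Hj.
  rewrite (HA j i) by assumption; lra.
Qed.

Lemma Anorm2_ext n A x y : (forall i, (i < n)%nat -> x i = y i) -> Anorm2 n A x = Anorm2 n A y.
Proof.
  intros H; unfold Anorm2; rewrite !Ainner_dot; apply dot_ext; [assumption|].
  intros; now apply mulv_ext.
Qed.

Lemma Anorm2_add n A x y a : sym n A ->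
  Anorm2 n A (fun i => x i + a * y i)
  = Anorm2 n A x + 2 * a * dot n y (mulv n A x) + a^2 * Anorm2 n A y.
Proof.
  intros HA; unfold Anorm2; rewrite !Ainner_dot.
  rewrite (dot_ext n _ (fun i => x i + a * y i) _
             (fun i => mulv n A x i + a * mulv n A y i)); [|reflexivity|].
  2: { intros; rewrite mulv_plus, mulv_scal; reflexivity. }
  rewrite dot_plus_r, dot_scal_r, !(dot_comm n (fun i => x i + a * y i)).
  rewrite !dot_plus_r, !dot_scal_r.
  rewrite (dot_comm n (mulv n A y) x), (dot_mulv_sym n A x y HA).
  rewrite !(dot_comm n (mulv n A _)); lra.
Qed.

Lemma Anorm2_nonneg n A x : posdef n A -> 0 <= Anorm2 n A x.
Proof.
  intros HA; destruct (classic (exists i, (i < n)%nat /\ x i <> 0)) as [H|H].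
  - left; now apply HA.
  - right; unfold Anorm2; rewrite Ainner_dot; unfold dot.
    rewrite (sumR_ext n _ (fun _ => 0)); [now rewrite sumR_0|].
    intros i Hi; destruct (Req_dec (x i) 0) as [->|Hx]; [lra|].
    exfalso; apply H; eauto.
Qed.

(** * Rayleigh bounds for symmetric matrices *)

Lemma Anorm2_S n A x : sym (S n) A ->
  Anorm2 (S n) A x = Anorm2 n A x + 2 * x n * mulv n A x n + A n n * (x n)^2.
Proof.
  intros HA; unfold Anorm2; rewrite !Ainner_dot; unfold dot, mulv; cbn [sumR].
  rewrite (sumR_ext n (fun i => x i * (sumR n (fun c => A i c * x c) + A i n * x n))
             (fun i => x i * sumR n (fun c => A i c * x c) + x n * (A n i * x i))).
  - rewrite sumR_plus, sumR_scal; lra.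
  - intros i Hi; rewrite (HA i n) by lia; lra.
Qed.

(** Takes the place of compactness of the unit sphere: eliminating the last coordinate leaves a
    positive definite form in one dimension less, so a constant can be built by induction. *)
Lemma posdef_coercive n A : sym n A -> posdef n A ->
  exists c, 0 < c /\ forall x, c * dot n x x <= Anorm2 n A x.
Proof.
  revert A; induction n as [|n IH]; intros A HA HP.
  { exists 1; split; [lra|]; intros x; unfold dot, Anorm2, Ainner; simpl; lra. }
  set (p := A n n).
  assert (Hp : 0 < p).
  { assert (H : Ainner (S n) A (unitv n) (unitv n) > 0)
      by (apply HP; exists n; rewrite unitv_same; split; [lia|lra]).
    rewrite Ainner_dot, dot_unitv, mulv_unitv in H by lia; exact H. }
  (* Schur complement of the last pivot *)
  set (B := fun i j => A i j - A n i * A n j / p).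
  assert (HB : forall x, Anorm2 n B x = Anorm2 n A x - (mulv n A x n)^2 / p).
  { intros x; unfold Anorm2; rewrite !Ainner_dot.
    rewrite (dot_ext n x x (mulv n B x)
      (fun i => mulv n A x i + (- (mulv n A x n / p)) * A n i)); [|reflexivity|].
    - rewrite dot_plus_r, dot_scal_r, (dot_comm n x (A n)).
      change (dot n (A n) x) with (mulv n A x n); field; lra.
    - intros i Hi; unfold mulv at 1, B.
      rewrite (sumR_ext n _ (fun c => A i c * x c + (- (A n i / p)) * (A n c * x c)))
        by (intros; field; lra).
      rewrite sumR_plus, sumR_scal; unfold mulv; field; lra. }
  destruct (IH B) as [c [Hc HcB]].
  { intros i j Hi Hj; unfold B; rewrite (HA i j) by lia; lra. }
  { intros x [i [Hi Hx]].
    (* The last coordinate of [y] minimises the form for given [x]; the minimum is the value of the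
       Schur complement at [x]. *)
    set (y := fun j => if Nat.eqb j n then - (mulv n A x n / p) else x j).
    assert (Hy : forall j, (j < n)%nat -> y j = x j).
    { intros j Hj; unfold y; now rewrite (proj2 (Nat.eqb_neq j n)) by lia. }
    assert (Hyn : y n = - (mulv n A x n / p)) by (unfold y; now rewrite Nat.eqb_refl).
    assert (H : Anorm2 (S n) A y > 0).
    { apply HP; exists i; split; [lia|]. rewrite Hy; auto. }
    rewrite Anorm2_S, Hyn, (Anorm2_ext n A y x), (mulv_ext n A y x) in H by assumption.
    change (Anorm2 n B x > 0); rewrite HB.
    replace (Anorm2 n A x - (mulv n A x n)^2 / p) with
      (Anorm2 n A x + 2 * - (mulv n A x n / p) * mulv n A x n
       + A n n * (- (mulv n A x n / p))^2); [exact H|fold p; field; lra]. }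
  set (k := sumR n (fun j => (A n j)^2) / p^2).
  assert (Hk : 0 <= k).
  { unfold k; apply Rmult_le_pos; [apply sumR_nonneg; intros; nra|].
    left; apply Rinv_0_lt_compat; nra. }
  set (c1 := c / (1 + 2 * k)).
  assert (Hc1 : c1 * (1 + 2 * k) = c) by (unfold c1; field; lra).
  assert (Hc1p : 0 < c1) by nra.
  (* From x_n = q - l/p follows x_n^2 <= 2 q^2 + 2 k |x|^2. The bound [c1] lets c |x|^2 cover the
     terms in |x|^2, and p/2 lets p q^2 cover 2 q^2. *)
  exists (Rmin c1 (p / 2)); split; [apply Rmin_glb_lt; lra|].
  intros x; rewrite Anorm2_S by assumption.
  set (l := mulv n A x n) in *; set (q := x n + l / p).
  replace (Anorm2 n A x + 2 * x n * l + A n n * (x n)^2) with (Anorm2 n B x + p * q^2)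
    by (rewrite HB; unfold q; fold l p; field; lra).
  assert (Hl : (l / p)^2 <= k * dot n x x).
  { assert (Hl : l^2 <= sumR n (fun j => (A n j)^2) * dot n x x).
    { eapply Rle_trans; [apply sumR_cauchy|].
      apply Req_le; f_equal; apply sumR_ext; intros; lra. }
    unfold k; replace ((l / p)^2) with (l^2 * / p^2) by (field; lra).
    replace (sumR n (fun j => (A n j)^2) / p^2 * dot n x x)
      with (sumR n (fun j => (A n j)^2) * dot n x x * / p^2) by (field; lra).
    apply Rmult_le_compat_r; [left; apply Rinv_0_lt_compat; nra|assumption]. }
  change (dot (S n) x x) with (dot n x x + x n * x n).
  assert (Hxn : x n * x n <= 2 * q^2 + 2 * k * dot n x x).
  { replace (x n) with (q - l / p) by (unfold q; lra).
    assert (0 <= (q + l / p)^2) by apply pow2_ge_0; nra. }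
  assert (Hm1 := Rmin_l c1 (p / 2)); assert (Hm2 := Rmin_r c1 (p / 2)).
  assert (Hmp : 0 < Rmin c1 (p / 2)) by (apply Rmin_glb_lt; lra).
  set (m := Rmin c1 (p / 2)) in *.
  specialize (HcB x); assert (Hd := dot_nonneg n x).
  assert (m * (1 + 2 * k) * dot n x x <= c * dot n x x)
    by (rewrite <- Hc1; apply Rmult_le_compat_r; nra).
  assert (m * (2 * q^2) <= p * q^2) by (assert (0 <= q^2) by apply pow2_ge_0; nra).
  nra.
Qed.

(** * Extreme eigenvalues as bounds of the quadratic form *)

Definition shift (A : nat -> nat -> R) (t : R) (i j : nat) : R := A i j - t * unitv i j.

Lemma mulv_shift n A t x r : (r < n)%nat -> mulv n (shift A t) x r = mulv n A x r - t * x r.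
Proof.
  intros Hr; unfold mulv, shift.
  rewrite (sumR_ext n _ (fun c => A r c * x c + (- t) * (unitv r c * x c))) by (intros; lra).
  rewrite sumR_plus, sumR_scal, sumR_unitv by assumption; lra.
Qed.

Lemma Anorm2_shift n A t x : Anorm2 n (shift A t) x = Anorm2 n A x - t * dot n x x.
Proof.
  unfold Anorm2; rewrite !Ainner_dot.
  rewrite (dot_ext n x x _ (fun i => mulv n A x i + (- t) * x i)); [|reflexivity|].
  - rewrite dot_plus_r, dot_scal_r; lra.
  - intros; rewrite mulv_shift by assumption; lra.
Qed.

(** A zero of a nonnegative form is a minimum, so the derivative in every coordinate direction
    vanishes there. *)
Lemma psd_kernel n A x : sym n A -> (forall y, 0 <= Anorm2 n A y) -> Anorm2 n A x <= 0 ->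
  forall i, (i < n)%nat -> mulv n A x i = 0.
Proof.
  intros HA Hpsd Hx i Hi.
  assert (H0 : Anorm2 n A x = 0) by (apply Rle_antisym; auto).
  assert (Hq : forall a, 0 <= 2 * a * mulv n A x i + a^2 * Anorm2 n A (unitv i)).
  { intros a; assert (H := Hpsd (fun j => x j + a * unitv i j)).
    rewrite Anorm2_add, H0, dot_unitv in H by assumption; lra. }
  set (m := mulv n A x i) in *; set (s := Anorm2 n A (unitv i)) in *.
  assert (Hs : 0 <= s) by apply Hpsd.
  (* Close to the minimiser -m/s of the quadratic in a; the denominator 1 + s stays positive when s
     = 0. *)
  assert (H := Hq (- m / (1 + s))).
  replace (2 * (- m / (1 + s)) * m + (- m / (1 + s))^2 * s)
    with (- (m^2 * ((2 + s) / (1 + s)^2))) in H by (field; lra).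
  assert (Hc : 0 < (2 + s) / (1 + s)^2) by (apply Rdiv_lt_0_compat; nra).
  assert (0 <= m^2) by apply pow2_ge_0.
  assert (m^2 = 0) by nra. nra.
Qed.

(** Expand |x + A x|^2 >= 0 and bound |A x|^2 by the squared Frobenius norm [F] times |x|^2. Some
    such bound must exist before a supremum of them can be taken. *)
Lemma Anorm2_lower_bound n A : exists t, forall x, t * dot n x x <= Anorm2 n A x.
Proof.
  set (F := sumR n (fun r => sumR n (fun c => (A r c)^2))).
  exists (- ((1 + F) / 2)); intros x.
  assert (HF : dot n (mulv n A x) (mulv n A x) <= F * dot n x x).
  { unfold F, dot at 1; rewrite Rmult_comm, <- sumR_scal; apply sumR_le; intros r _.
    replace (mulv n A x r * mulv n A x r) with ((mulv n A x r)^2) by ring.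
    eapply Rle_trans; [apply sumR_cauchy|].
    rewrite Rmult_comm; apply Req_le; f_equal; apply sumR_ext; intros; lra. }
  assert (H : 0 <= dot n (fun i => x i + mulv n A x i) (fun i => x i + mulv n A x i))
    by apply dot_nonneg.
  rewrite dot_plus_r, !(dot_comm n (fun i => x i + mulv n A x i)), !dot_plus_r in H.
  rewrite (dot_comm n (mulv n A x) x) in H.
  unfold Anorm2; rewrite Ainner_dot; lra.
Qed.

(** t is the supremum of the lower bounds of the Rayleigh quotient. Were A - t I positive definite,
    coercivity would allow a larger t; hence its form is not positive at some nonzero v, and
    [psd_kernel] makes v an eigenvector. *)
Lemma min_eigenvalue_exists n A : (0 < n)%nat -> sym n A ->
  exists t, is_eigenvalue n A t /\ forall x, t * dot n x x <= Anorm2 n A x.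
Proof.
  intros Hn HA.
  set (P := fun t => forall x, t * dot n x x <= Anorm2 n A x).
  assert (He : dot n (unitv 0) (unitv 0) = 1) by (rewrite dot_unitv by assumption; apply unitv_same).
  destruct (completeness P) as [t [Hub Hlub]].
  { exists (Anorm2 n A (unitv 0)); intros t Ht; specialize (Ht (unitv 0)); rewrite He in Ht; lra. }
  { apply Anorm2_lower_bound. }
  assert (Ht : P t).
  { intros x; destruct (Rle_lt_dec (t * dot n x x) (Anorm2 n A x)) as [H|H]; [exact H|exfalso].
    assert (Hd : 0 < dot n x x).
    { destruct (dot_nonneg n x) as [Hd|Hd]; [exact Hd|exfalso].
      destruct (Anorm2_lower_bound n A) as [s Hs].
      specialize (Hs x); rewrite <- Hd in Hs, H; lra. }
    assert (t <= Anorm2 n A x / dot n x x).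
    { apply Hlub; intros s Hs; apply Rmult_le_reg_r with (dot n x x); [assumption|].
      replace (Anorm2 n A x / dot n x x * dot n x x) with (Anorm2 n A x) by (field; lra).
      apply Hs. }
    assert (t * dot n x x <= Anorm2 n A x / dot n x x * dot n x x)
      by (apply Rmult_le_compat_r; lra).
    replace (Anorm2 n A x / dot n x x * dot n x x) with (Anorm2 n A x) in * by (field; lra).
    lra. }
  assert (Hsym : sym n (shift A t)).
  { intros i j Hi Hj; unfold shift, unitv; rewrite (HA i j), Nat.eqb_sym by assumption; reflexivity. }
  assert (Hnot : ~ posdef n (shift A t)).
  { intros HP; destruct (posdef_coercive n _ Hsym HP) as [c [Hc Hcx]].
    assert (t + c <= t); [|lra].
    apply Hub; intros x; specialize (Hcx x); rewrite Anorm2_shift in Hcx; lra. }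
  apply not_all_ex_not in Hnot; destruct Hnot as [v Hv].
  apply imply_to_and in Hv; destruct Hv as [Hv0 Hv].
  exists t; split; [|exact Ht].
  exists v; split; [exact Hv0|]; intros i Hi.
  assert (Hk : mulv n (shift A t) v i = 0).
  { apply psd_kernel; [assumption| |apply Rnot_gt_le, Hv|assumption].
    intros y; rewrite Anorm2_shift; specialize (Ht y); lra. }
  rewrite mulv_shift in Hk by assumption; unfold mulv in Hk; lra.
Qed.

Lemma rayleigh_min n A lmin x : (0 < n)%nat -> sym n A -> is_min_eigenvalue n A lmin ->
  lmin * dot n x x <= Anorm2 n A x.
Proof.
  intros Hn HA [_ Hmin]; destruct (min_eigenvalue_exists n A Hn HA) as [t [Ht Hx]].
  assert (lmin * dot n x x <= t * dot n x x)
    by (apply Rmult_le_compat_r; [apply dot_nonneg|auto]).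
  specialize (Hx x); lra.
Qed.

Lemma rayleigh_max n A lmax x : (0 < n)%nat -> sym n A -> is_max_eigenvalue n A lmax ->
  Anorm2 n A x <= lmax * dot n x x.
Proof.
  intros Hn HA [_ Hmax].
  (* The top of the spectrum of A is the bottom of the spectrum of -A. *)
  set (B := fun i j => (-1) * A i j).
  assert (HBm : forall y r, mulv n B y r = (-1) * mulv n A y r).
  { intros; unfold mulv, B; rewrite <- sumR_scal; apply sumR_ext; intros; lra. }
  destruct (min_eigenvalue_exists n B Hn) as [t [[v [Hv0 Hv]] Hx]].
  { intros i j Hi Hj; unfold B; now rewrite HA. }
  assert (Ht : - t <= lmax).
  { apply Hmax; exists v; split; [exact Hv0|]; intros i Hi.
    specialize (Hv i Hi); fold (mulv n B v i) in Hv; fold (mulv n A v i).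
    rewrite HBm in Hv; lra. }
  assert (- t * dot n x x <= lmax * dot n x x)
    by (apply Rmult_le_compat_r; [apply dot_nonneg|auto]).
  specialize (Hx x); unfold Anorm2 in *; rewrite Ainner_dot in *.
  rewrite (dot_ext n x x (mulv n B x) (fun i => (-1) * mulv n A x i)), dot_scal_r in Hx
    by (auto; intros; apply HBm); lra.
Qed.

Lemma eigenvalue_rayleigh n A lam : is_eigenvalue n A lam ->
  exists v, 0 < dot n v v /\ (exists i, (i < n)%nat /\ v i <> 0) /\
            Anorm2 n A v = lam * dot n v v.
Proof.
  intros [v [[i [Hi Hvi]] Hv]]; exists v; split; [now apply dot_pos with i|].
  split; [eauto|].
  unfold Anorm2; rewrite Ainner_dot, <- dot_scal_r; apply dot_ext; auto.
Qed.

Lemma eigenvalue_pos n A lam : posdef n A -> is_eigenvalue n A lam -> 0 < lam.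
Proof.
  intros HP He; destruct (eigenvalue_rayleigh n A lam He) as [v [Hd [Hv Hq]]].
  assert (H : Anorm2 n A v > 0) by now apply HP.
  rewrite Hq in H; nra.
Qed.

Lemma mulv_sq_le n A lmax x : (0 < n)%nat -> sym n A -> posdef n A ->
  is_max_eigenvalue n A lmax ->
  dot n (mulv n A x) (mulv n A x) <= lmax * Anorm2 n A x.
Proof.
  intros Hn HA HP Hm; set (y := mulv n A x).
  assert (Hx : 0 <= Anorm2 n A x) by now apply Anorm2_nonneg.
  assert (Hy := rayleigh_max n A lmax y Hn HA Hm).
  assert (Hl : 0 < lmax) by (apply (eigenvalue_pos n A); [assumption|apply Hm]).
  assert (Hd := dot_nonneg n y).
  (* Cauchy-Schwarz for the A-inner product of x and Ax, as a discriminant *)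
  assert (H : 0 <= Anorm2 n A (fun i => x i + (- / lmax) * y i)) by now apply Anorm2_nonneg.
  rewrite Anorm2_add in H by assumption; fold y in H.
  assert ((- / lmax)^2 * Anorm2 n A y <= (- / lmax)^2 * (lmax * dot n y y))
    by (apply Rmult_le_compat_l; [apply pow2_ge_0|assumption]).
  replace ((- / lmax)^2 * (lmax * dot n y y)) with (/ lmax * dot n y y) in * by (field; lra).
  apply Rmult_le_reg_l with (/ lmax); [now apply Rinv_0_lt_compat|].
  replace (/ lmax * (lmax * Anorm2 n A x)) with (Anorm2 n A x) by (field; lra); lra.
Qed.

(** Expand |A x - lmin x|^2 >= 0 and use the Rayleigh bound for lmin |x|^2. *)
Lemma mulv_sq_ge n A lmin x : (0 < n)%nat -> sym n A -> posdef n A ->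
  is_min_eigenvalue n A lmin ->
  lmin * Anorm2 n A x <= dot n (mulv n A x) (mulv n A x).
Proof.
  intros Hn HA HP Hm; set (y := mulv n A x).
  assert (Hx := rayleigh_min n A lmin x Hn HA Hm).
  assert (Hl : 0 < lmin) by (apply (eigenvalue_pos n A); [assumption|apply Hm]).
  assert (H := dot_nonneg n (fun i => y i + (- lmin) * x i)).
  rewrite dot_plus_r, dot_scal_r, !(dot_comm n (fun i => y i + _)), !dot_plus_r, !dot_scal_r in H.
  unfold Anorm2 in *; rewrite Ainner_dot in *; fold y in Hx |- *.
  rewrite (dot_comm n y x) in H; nra.
Qed.

(** Needed for 1 - lmax/n > 0, on which the logarithm and the negative powers rest. The eigenvector
    equation is read at a component of largest modulus: all entries have modulus at most 1, and n >=
    2 supplies an off-diagonal one with modulus strictly below 1. *)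
Lemma max_eigenvalue_lt n A lmax : (2 <= n)%nat -> sym n A -> posdef n A ->
  (forall i, (i < n)%nat -> A i i = 1) -> is_max_eigenvalue n A lmax -> lmax < INR n.
Proof.
  intros Hn HA HP H1 [[v [[k [Hk Hvk]] Hv]] _].
  assert (Hoff : forall i j, (i < n)%nat -> (j < n)%nat -> i <> j -> (A i j)^2 < 1).
  { intros i j Hi Hj Hij.
    (* The vector e_i - A_ij e_j has energy 1 - A_ij^2. *)
    assert (H : Anorm2 n A (fun c => unitv i c + (- A i j) * unitv j c) > 0).
    { apply HP; exists i; split; [assumption|].
      rewrite unitv_same, unitv_diff by auto; lra. }
    rewrite Anorm2_add, dot_unitv, mulv_unitv in H by assumption.
    unfold Anorm2 in H; rewrite !Ainner_dot, !dot_unitv, !mulv_unitv in H by assumption.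
    rewrite !H1, (HA j i) in H by assumption; lra. }
  assert (Hmax : forall m, (0 < m)%nat -> exists i, (i < m)%nat /\
                   forall j, (j < m)%nat -> Rabs (v j) <= Rabs (v i)).
  { induction m as [|m IH]; intros Hm; [lia|].
    destruct m as [|m].
    { exists O; split; [lia|]; intros j Hj; replace j with O by lia; lra. }
    destruct IH as [i [Hi Hm']]; [lia|].
    destruct (Rle_lt_dec (Rabs (v i)) (Rabs (v (S m)))).
    - exists (S m); split; [lia|]; intros j Hj.
      destruct (Nat.eq_dec j (S m)) as [->|]; [lra|].
      specialize (Hm' j); apply Rle_trans with (Rabs (v i)); [apply Hm'; lia|lra].
    - exists i; split; [lia|]; intros j Hj.
      destruct (Nat.eq_dec j (S m)) as [->|]; [lra|apply Hm'; lia]. }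
  destruct (Hmax n) as [i [Hi Hvi]]; [lia|]; clear Hmax.
  assert (Hpos : 0 < Rabs (v i)).
  { apply Rlt_le_trans with (Rabs (v k)); [now apply Rabs_pos_lt|auto]. }
  set (a := Rabs (v i)) in *.
  assert (Hterm : forall j, (j < n)%nat -> 0 <= a - Rabs (A i j * v j)).
  { intros j Hj; rewrite Rabs_mult.
    assert (Rabs (A i j) <= 1).
    { destruct (Nat.eq_dec i j) as [<-|Hij]; [rewrite H1, Rabs_R1 by assumption; lra|].
      specialize (Hoff i j Hi Hj Hij); rewrite <- (pow2_abs (A i j)) in Hoff.
      assert (0 <= Rabs (A i j)) by apply Rabs_pos; nra. }
    specialize (Hvi j Hj); assert (0 <= Rabs (v j)) by apply Rabs_pos.
    assert (0 <= Rabs (A i j)) by apply Rabs_pos; nra. }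
  assert (Habs : forall m f, Rabs (sumR m f) <= sumR m (fun j => Rabs (f j))).
  { induction m as [|m IH]; intros f; simpl; [rewrite Rabs_R0; lra|].
    eapply Rle_trans; [apply Rabs_triang|]; specialize (IH f); lra. }
  assert (Hj : exists j, (j < n)%nat /\ i <> j).
  { destruct (Nat.eq_dec i 0); [exists 1%nat|exists 0%nat]; lia. }
  destruct Hj as [j [Hj Hij]].
  assert (Hgap : a - Rabs (A i j * v j) <= sumR n (fun c => a - Rabs (A i c * v c)))
    by now apply (sumR_term_le n (fun c => a - Rabs (A i c * v c))).
  assert (Hs : sumR n (fun c => a - Rabs (A i c * v c))
               = INR n * a - sumR n (fun c => Rabs (A i c * v c))).
  { rewrite (sumR_ext n _ (fun c => a + (-1) * Rabs (A i c * v c))) by (intros; lra).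
    rewrite sumR_plus, sumR_scal, sumR_const; lra. }
  assert (Hstrict : Rabs (A i j * v j) < a).
  { rewrite Rabs_mult; specialize (Hoff i j Hi Hj Hij); rewrite <- (pow2_abs (A i j)) in Hoff.
    assert (0 <= Rabs (A i j)) by apply Rabs_pos.
    specialize (Hvi j Hj); assert (0 <= Rabs (v j)) by apply Rabs_pos.
    assert (Rabs (A i j) < 1) by nra. nra. }
  assert (Hlam : Rabs (lmax * v i) <= sumR n (fun c => Rabs (A i c * v c)))
    by (rewrite <- Hv by assumption; apply Habs).
  rewrite Rabs_mult in Hlam; fold a in Hlam.
  assert (lmax <= Rabs lmax) by apply Rle_abs.
  apply Rmult_lt_reg_r with a; [assumption|]; nra.
Qed.

(** * Expectation over independent uniform directions *)

Definition upd (d : nat -> nat) (j k : nat) : nat -> nat :=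
  fun i => if Nat.eqb i j then k else d i.

Lemma upd_same d j k : upd d j k j = k.
Proof. unfold upd; now rewrite Nat.eqb_refl. Qed.

Lemma upd_diff d j k i : i <> j -> upd d j k i = d i.
Proof. intros H; unfold upd; now rewrite (proj2 (Nat.eqb_neq i j) H). Qed.

Lemma upd_upd d j k k' : upd (upd d j k) j k' = upd d j k'.
Proof. apply functional_extensionality; intros i; unfold upd; destruct (Nat.eqb i j); auto. Qed.

Lemma upd_comm d i j k l : i <> j -> upd (upd d i k) j l = upd (upd d j l) i k.
Proof.
  intros H; apply functional_extensionality; intros a; unfold upd.
  destruct (Nat.eqb_spec a i), (Nat.eqb_spec a j); congruence.
Qed.

Definition valid (n : nat) (d : nat -> nat) : Prop := forall i, (d i < n)%nat.

Lemma valid_upd n d j k : valid n d -> (k < n)%nat -> valid n (upd d j k).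
Proof. intros Hd Hk i; unfold upd; destruct (Nat.eqb i j); auto. Qed.

Definition mean (n : nat) (f : nat -> R) : R := sumR n f / INR n.

Lemma mean_ext n f g : (forall k, (k < n)%nat -> f k = g k) -> mean n f = mean n g.
Proof. intros H; unfold mean; now rewrite (sumR_ext n f g). Qed.

Lemma mean_const n a : (0 < n)%nat -> mean n (fun _ => a) = a.
Proof.
  intros Hn; unfold mean; rewrite sumR_const; field; apply not_0_INR; lia.
Qed.

Lemma mean_le n f g : (0 < n)%nat -> (forall k, (k < n)%nat -> f k <= g k) -> mean n f <= mean n g.
Proof.
  intros Hn H; apply Rmult_le_compat_r; [|now apply sumR_le].
  left; apply Rinv_0_lt_compat, lt_0_INR; lia.
Qed.

Lemma avg_S n m F : avg n (S m) F = mean n (fun k => avg n m (fun d => F (upd d m k))).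
Proof. reflexivity. Qed.

Lemma avg_le n m F G : (0 < n)%nat -> (forall d, valid n d -> F d <= G d) ->
  avg n m F <= avg n m G.
Proof.
  intros Hn; revert F G; induction m as [|m IH]; intros F G H.
  - simpl; apply H; intros i; exact Hn.
  - rewrite !avg_S; apply mean_le; [assumption|]; intros k Hk.
    apply IH; intros d Hd; apply H; now apply valid_upd.
Qed.

Lemma avg_ext n m F G : (0 < n)%nat -> (forall d, valid n d -> F d = G d) ->
  avg n m F = avg n m G.
Proof.
  intros Hn H; apply Rle_antisym; apply avg_le; intros; try assumption;
    rewrite H by assumption; apply Rle_refl.
Qed.

Lemma avg_plus n m F G : avg n m (fun d => F d + G d) = avg n m F + avg n m G.
Proof.
  revert F G; induction m as [|m IH]; intros F G; [reflexivity|].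
  rewrite !avg_S; unfold mean.
  rewrite (sumR_ext n _ (fun k => avg n m (fun d => F (upd d m k)) + avg n m (fun d => G (upd d m k))))
    by (intros; apply (IH (fun d => F (upd d m i)))).
  rewrite sumR_plus; unfold Rdiv; ring.
Qed.

Lemma avg_scal n m a F : avg n m (fun d => a * F d) = a * avg n m F.
Proof.
  revert F; induction m as [|m IH]; intros F; [reflexivity|].
  rewrite !avg_S; unfold mean.
  rewrite (sumR_ext n _ (fun k => a * avg n m (fun d => F (upd d m k))))
    by (intros; apply (IH (fun d => F (upd d m i)))).
  rewrite sumR_scal; unfold Rdiv; ring.
Qed.

Lemma avg_const n m a : (0 < n)%nat -> avg n m (fun _ => a) = a.
Proof.
  intros Hn; induction m as [|m IH]; [reflexivity|].
  rewrite avg_S, (mean_ext n _ (fun _ => a)); [now apply mean_const|auto].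
Qed.

Lemma avg_nonneg n m F : (0 < n)%nat -> (forall d, valid n d -> 0 <= F d) -> 0 <= avg n m F.
Proof. intros Hn H; rewrite <- (avg_const n m 0 Hn); now apply avg_le. Qed.

Lemma avg_sumR n m p (F : nat -> (nat -> nat) -> R) : (0 < n)%nat ->
  avg n m (fun d => sumR p (fun i => F i d)) = sumR p (fun i => avg n m (F i)).
Proof.
  intros Hn; induction p as [|p IH]; simpl; [now apply avg_const|].
  now rewrite avg_plus, IH.
Qed.

Lemma avg_mean n m (F : nat -> (nat -> nat) -> R) : (0 < n)%nat ->
  avg n m (fun d => mean n (fun k => F k d)) = mean n (fun k => avg n m (F k)).
Proof.
  intros Hn; unfold mean.
  rewrite (avg_ext n m _ (fun d => / INR n * sumR n (fun k => F k d)))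
    by (auto; intros; unfold Rdiv; ring).
  rewrite avg_scal, avg_sumR by assumption; unfold Rdiv; ring.
Qed.

(* Redrawing the j-th direction does not change the expectation, which serves as conditioning
   on all the other directions. *)
Lemma avg_resample n N j F : (0 < n)%nat -> (j < N)%nat ->
  avg n N F = avg n N (fun d => mean n (fun k => F (upd d j k))).
Proof.
  intros Hn; revert F; induction N as [|N IH]; intros F Hj; [lia|].
  rewrite !avg_S; destruct (Nat.eq_dec j N) as [->|Hne].
  - rewrite (mean_ext n (fun k => avg n N (fun d => mean n (fun k0 => F (upd (upd d N k) N k0))))
      (fun _ => mean n (fun k => avg n N (fun d => F (upd d N k))))).
    + now rewrite mean_const.
    + intros k _; rewrite <- (avg_mean n N (fun k d => F (upd d N k))) by assumption.
      apply avg_ext; [assumption|]; intros d _; apply mean_ext; intros; now rewrite upd_upd.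
  - apply mean_ext; intros k _.
    rewrite (IH (fun d => F (upd d N k))) by lia.
    apply avg_ext; [assumption|]; intros d _; apply mean_ext; intros; now rewrite upd_comm.
Qed.

(** Measurability with respect to the first m directions. *)
Definition depends_below (m : nat) (F : (nat -> nat) -> R) : Prop :=
  forall d d', (forall i, (i < m)%nat -> d i = d' i) -> F d = F d'.

(** Brings quantities with different natural horizons under one expectation. *)
Lemma avg_horizon n m N F : (0 < n)%nat -> depends_below m F -> (m <= N)%nat ->
  avg n N F = avg n m F.
Proof.
  intros Hn HF; induction 1 as [|N HN IH]; [reflexivity|].
  rewrite avg_S, (mean_ext n _ (fun _ => avg n N F)); [now rewrite mean_const|].
  intros k _; apply avg_ext; [assumption|]; intros d _.
  apply HF; intros i Hi; apply upd_diff; lia.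
Qed.

Lemma maxR_ge n f k : (k < n)%nat -> f k <= maxR n f.
Proof.
  induction n as [|n IH]; intros Hk; [lia|].
  destruct n as [|n]; [replace k with O by lia; simpl; lra|].
  change (maxR (S (S n)) f) with (Rmax (maxR (S n) f) (f (S n))).
  destruct (Nat.eq_dec k (S n)) as [->|]; [apply Rmax_r|].
  eapply Rle_trans; [apply IH; lia|apply Rmax_l].
Qed.

(** For l < j, the indicator of j - tau <= l, that is of the updates which a read at time j may
    miss; written without truncated subtraction. *)
Definition window (tau j l : nat) : R := if Nat.leb j (l + tau) then 1 else 0.

Lemma window_01 tau j l : window tau j l = 0 \/ window tau j l = 1.
Proof. unfold window; destruct (Nat.leb j (l + tau)); auto. Qed.

Lemma sumR_window tau j : sumR j (window tau j) <= INR tau.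
Proof.
  destruct (Nat.le_gt_cases j tau) as [H|H].
  - apply Rle_trans with (sumR j (fun _ => 1)).
    + apply sumR_le; intros i _; destruct (window_01 tau j i) as [-> | ->]; lra.
    + rewrite sumR_const, Rmult_1_r; now apply le_INR.
  - replace (sumR j (window tau j)) with (sumR ((j - tau) + tau) (window tau j))
      by (f_equal; lia).
    rewrite sumR_add, (sumR_ext (j - tau) _ (fun _ => 0)), sumR_0.
    + rewrite Rplus_0_l; apply Rle_trans with (sumR tau (fun _ => 1)).
      * apply sumR_le; intros i _; destruct (window_01 tau j (j - tau + i)) as [-> | ->]; lra.
      * rewrite sumR_const; lra.
    + intros i Hi; unfold window; destruct (Nat.leb_spec j (i + tau)); [lia|reflexivity].
Qed.

(** * The inconsistent-read iteration *)

Section Iteration.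

Variables (n : nat) (A : nat -> nat -> R) (xs x0 : nat -> R) (lmin lmax beta : R)
  (tau : nat) (K : nat -> nat -> bool).
Hypotheses (Hn : (0 < n)%nat) (Hsym : sym n A) (Hpd : posdef n A)
  (Hdiag : forall i, (i < n)%nat -> A i i = 1)
  (Hmin : is_min_eigenvalue n A lmin) (Hmax : is_max_eigenvalue n A lmax)
  (HK : forall j i, (i + tau + 1 <= j)%nat -> K j i = true).

Definition gam (d : nat -> nat) (j : nat) : R :=
  Ainner n A (fun c => xs c - xK x0 beta K d (gammas n A xs x0 beta K d j) j c) (unitv (d j)).

(* The error of the partial iterate that has only applied the updates i < t with i in J. *)
Definition err (J : nat -> bool) (d : nat -> nat) (t : nat) : nat -> R :=
  fun c => x0 c - xs c + sumR t (fun i => if J i then beta * gam d i * unitv (d i) c else 0).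

Definition full : nat -> bool := fun _ => true.

Lemma length_gammas d m : length (gammas n A xs x0 beta K d m) = m.
Proof. induction m as [|m IH]; simpl; [reflexivity|]. rewrite length_app, IH; simpl; lia. Qed.

Lemma nth_gammas d m i : (i < m)%nat -> nth i (gammas n A xs x0 beta K d m) 0 = gam d i.
Proof.
  induction m as [|m IH]; intros Hi; [lia|simpl].
  destruct (Nat.eq_dec i m) as [->|].
  - rewrite app_nth2; rewrite length_gammas; [|lia]; now rewrite Nat.sub_diag.
  - rewrite app_nth1; [apply IH; lia|rewrite length_gammas; lia].
Qed.

Lemma xK_err d j c : xK x0 beta K d (gammas n A xs x0 beta K d j) j c - xs c = err (K j) d j c.
Proof.
  unfold xK, err.
  rewrite (sumR_ext j _ (fun i => if K j i then beta * gam d i * unitv (d i) c else 0)); [lra|].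
  intros i Hi; now rewrite nth_gammas.
Qed.

Lemma xiter_err d m c : xiter n A xs x0 beta K d m c - xs c = err full d m c.
Proof.
  unfold xiter, err, full.
  rewrite (sumR_ext m _ (fun i => beta * gam d i * unitv (d i) c)); [lra|].
  intros i Hi; now rewrite nth_gammas.
Qed.

Lemma gam_mulv d j : valid n d -> gam d j = - mulv n A (err (K j) d j) (d j).
Proof.
  intros Hd; unfold gam; rewrite Ainner_dot, dot_unitv by apply Hd.
  rewrite (mulv_ext n A _ (fun c => (-1) * err (K j) d j c)), mulv_scal; [lra|].
  intros c _; rewrite <- xK_err; lra.
Qed.

Lemma gammas_ext d d' m : (forall i, (i < m)%nat -> d i = d' i) ->
  gammas n A xs x0 beta K d m = gammas n A xs x0 beta K d' m.
Proof.
  induction m as [|m IH]; intros H; simpl; [reflexivity|].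
  rewrite IH, (H m) by auto.
  do 3 f_equal; apply functional_extensionality; intros c; f_equal; unfold xK; f_equal.
  apply sumR_ext; intros i Hi; now rewrite (H i) by lia.
Qed.

Lemma gam_ext d d' j : (forall i, (i <= j)%nat -> d i = d' i) -> gam d j = gam d' j.
Proof.
  intros H; rewrite <- (nth_gammas d (S j)), <- (nth_gammas d' (S j)) by lia.
  rewrite (gammas_ext d d'); [reflexivity|]. intros; apply H; lia.
Qed.

Lemma err_ext J d d' t : (forall i, (i < t)%nat -> d i = d' i) -> err J d t = err J d' t.
Proof.
  intros H; apply functional_extensionality; intros c; unfold err; f_equal.
  apply sumR_ext; intros i Hi; rewrite (gam_ext d d'), (H i); auto.
  intros; apply H; lia.
Qed.

Lemma err_upd J d t j k : (t <= j)%nat -> err J (upd d j k) t = err J d t.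
Proof. intros H; apply err_ext; intros; apply upd_diff; lia. Qed.

Lemma err_agree J J' d t : (forall i, (i < t)%nat -> J i = J' i) -> err J d t = err J' d t.
Proof.
  intros H; apply functional_extensionality; intros c; unfold err; f_equal.
  apply sumR_ext; intros i Hi; now rewrite H.
Qed.

(** * Second moments of partial errors and of the gammas *)

Definition errsq (J : nat -> bool) (t : nat) : R :=
  avg n t (fun d => Anorm2 n A (err J d t)).

Definition gamsq (j : nat) : R := avg n (S j) (fun d => (gam d j)^2).

Lemma errsq_horizon J t N : (t <= N)%nat ->
  avg n N (fun d => Anorm2 n A (err J d t)) = errsq J t.
Proof.
  intros H; apply avg_horizon; [assumption| |assumption].
  intros d d' Hd; now rewrite (err_ext J d d').
Qed.

Lemma gamsq_horizon j N : (j < N)%nat -> avg n N (fun d => (gam d j)^2) = gamsq j.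
Proof.
  intros H; apply avg_horizon; [assumption| |assumption].
  intros d d' Hd; rewrite (gam_ext d d'); [reflexivity|]. intros; apply Hd; lia.
Qed.

Lemma errsq_Eerr m : Eerr n A xs x0 beta K m = errsq full m.
Proof.
  apply avg_ext; [assumption|]; intros d _; apply Anorm2_ext; intros; apply xiter_err.
Qed.

Lemma errsq_nonneg J t : 0 <= errsq J t.
Proof. apply avg_nonneg; [assumption|]; intros; now apply Anorm2_nonneg. Qed.

Lemma gamsq_nonneg j : 0 <= gamsq j.
Proof. apply avg_nonneg; [assumption|]; intros; apply pow2_ge_0. Qed.

(** The error at time t does not involve d_t, so redrawing d_t averages the squared component over
    all coordinates. *)
Lemma avg_residual_sq J t :
  avg n (t + 1) (fun d => (mulv n A (err J d t) (d t))^2)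
  = / INR n * avg n (t + 1) (fun d => dot n (mulv n A (err J d t)) (mulv n A (err J d t))).
Proof.
  rewrite (avg_resample n (t + 1) t), <- avg_scal by (assumption || lia).
  apply avg_ext; [assumption|]; intros d _; unfold mean, dot.
  rewrite Rmult_comm; unfold Rdiv; f_equal; apply sumR_ext; intros k Hk.
  rewrite upd_same, err_upd by lia; ring.
Qed.

Lemma INR_n_pos : 0 < INR n.
Proof. apply lt_0_INR; lia. Qed.

Lemma avg_residual_sq_le J t :
  avg n (t + 1) (fun d => (mulv n A (err J d t) (d t))^2) <= lmax / INR n * errsq J t.
Proof.
  rewrite avg_residual_sq, <- (errsq_horizon J t (t + 1)) by lia.
  replace (lmax / INR n) with (/ INR n * lmax) by (unfold Rdiv; ring).
  rewrite Rmult_assoc; apply Rmult_le_compat_l; [left; apply Rinv_0_lt_compat, INR_n_pos|].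
  rewrite <- avg_scal; apply avg_le; [assumption|]; intros d _; now apply mulv_sq_le.
Qed.

Lemma gamsq_ge j : lmin / INR n * errsq (K j) j <= gamsq j.
Proof.
  unfold gamsq; rewrite <- Nat.add_1_r.
  rewrite (avg_ext n _ _ (fun d => (mulv n A (err (K j) d j) (d j))^2))
    by (assumption || (intros; rewrite gam_mulv by assumption; ring)).
  rewrite avg_residual_sq, <- (errsq_horizon (K j) j (j + 1)) by lia.
  replace (lmin / INR n) with (/ INR n * lmin) by (unfold Rdiv; ring).
  rewrite Rmult_assoc; apply Rmult_le_compat_l; [left; apply Rinv_0_lt_compat, INR_n_pos|].
  rewrite <- avg_scal; apply avg_le; [assumption|]; intros d _; now apply mulv_sq_ge.
Qed.

Lemma Anorm2_err_S J d t : valid n d ->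
  Anorm2 n A (err J d (t + 1)) =
  if J t then Anorm2 n A (err J d t) + 2 * (beta * gam d t) * mulv n A (err J d t) (d t)
              + (beta * gam d t)^2
  else Anorm2 n A (err J d t).
Proof.
  intros Hd; rewrite Nat.add_1_r.
  destruct (J t) eqn:HS.
  - rewrite (Anorm2_ext n A _ (fun c => err J d t c + beta * gam d t * unitv (d t) c))
      by (intros; unfold err; simpl; rewrite HS; lra).
    rewrite Anorm2_add, dot_unitv by (assumption || apply Hd).
    unfold Anorm2 at 2; rewrite Ainner_dot, dot_unitv, mulv_unitv, Hdiag by apply Hd; ring.
  - apply Anorm2_ext; intros; unfold err; simpl; rewrite HS; lra.
Qed.

(* A single update along a unit vector can at most remove the component of the error along it. *)
Lemma errsq_step J t : (1 - lmax / INR n) * errsq J t <= errsq J (t + 1).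
Proof.
  apply Rle_trans with
    (avg n (t + 1) (fun d => Anorm2 n A (err J d t) + (-1) * (mulv n A (err J d t) (d t))^2)).
  - rewrite avg_plus, avg_scal, errsq_horizon by lia.
    assert (H := avg_residual_sq_le J t); lra.
  - apply avg_le; [assumption|]; intros d Hd; rewrite Anorm2_err_S by assumption.
    set (u := mulv n A (err J d t) (d t)); destruct (J t); [|nra].
    assert (0 <= (beta * gam d t + u)^2) by apply pow2_ge_0; nra.
Qed.

Lemma errsq_steps J t k : lmax < INR n ->
  (1 - lmax / INR n)^k * errsq J t <= errsq J (t + k).
Proof.
  intros Hlt.
  assert (Hq : 0 < 1 - lmax / INR n).
  { assert (lmax / INR n < 1); [|lra].
    apply Rmult_lt_reg_r with (INR n); [apply INR_n_pos|].
    unfold Rdiv; rewrite Rmult_assoc, Rinv_l by apply Rgt_not_eq, INR_n_pos; lra. }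
  induction k as [|k IH]; [rewrite Nat.add_0_r; simpl; lra|].
  replace (t + S k)%nat with (t + k + 1)%nat by lia.
  eapply Rle_trans; [|apply errsq_step].
  simpl; rewrite Rmult_assoc; apply Rmult_le_compat_l; lra.
Qed.

(** With K(j) frozen, the partial process has skipped nothing before s <= j - tau, so it starts from
    the true error there; each of the k later steps, applied or skipped, costs at most one
    factor. *)
Lemma errsq_read j s k : (s + k = j)%nat -> (tau <= k)%nat -> lmax < INR n ->
  (1 - lmax / INR n)^k * errsq full s <= errsq (K j) j.
Proof.
  intros Hj Hk Hlt; rewrite <- Hj at 2.
  replace (errsq full s) with (errsq (K j) s); [now apply errsq_steps|].
  apply avg_ext; [assumption|]; intros d _; f_equal; apply err_agree.
  intros i Hi; apply HK; lia.
Qed.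

(** * Updates missed by a read, and the one-step energy inequality *)

Definition delay_gap (d : nat -> nat) (j : nat) : R :=
  sumR j (fun l => if K j l then 0 else beta * gam d l * A (d j) (d l)).

Lemma mulv_sumR m (h : nat -> nat -> R) r :
  mulv n A (fun c => sumR m (fun l => h l c)) r = sumR m (fun l => mulv n A (h l) r).
Proof.
  induction m as [|m IH]; simpl.
  - unfold mulv; rewrite (sumR_ext n _ (fun _ => 0)), sumR_0; [reflexivity|intros; lra].
  - now rewrite <- IH, <- mulv_plus.
Qed.

Lemma residual_gap d j : valid n d ->
  mulv n A (err full d j) (d j) = - gam d j + delay_gap d j.
Proof.
  intros Hd; rewrite gam_mulv by assumption.
  rewrite (mulv_ext n A _ (fun c => err (K j) d j c
    + sumR j (fun l => if K j l then 0 else beta * gam d l * unitv (d l) c))).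
  - rewrite mulv_plus, mulv_sumR, Ropp_involutive; f_equal; apply sumR_ext; intros l _.
    destruct (K j l).
    + unfold mulv; rewrite (sumR_ext n _ (fun _ => 0)), sumR_0; [reflexivity|intros; lra].
    + now rewrite mulv_scal, mulv_unitv by apply Hd.
  - intros c _; unfold err, full; rewrite Rplus_assoc, <- sumR_plus; f_equal.
    apply sumR_ext; intros l _; destruct (K j l); lra.
Qed.

(** Missed updates lie in the window, so Cauchy-Schwarz against its indicator costs the factor tau
    and not j. *)
Lemma delay_gap_sq d j :
  (delay_gap d j)^2 <=
  INR tau * beta^2 * sumR j (fun l => window tau j l * ((gam d l)^2 * (A (d j) (d l))^2)).
Proof.
  set (a := fun l => if K j l then 0 else beta * gam d l * A (d j) (d l)).
  assert (Ha : forall l, a l = 0 \/ window tau j l = 1 /\ a l = beta * gam d l * A (d j) (d l)).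
  { intros l; unfold a; destruct (K j l) eqn:HKl; [now left|right; split; [|reflexivity]].
    unfold window; destruct (Nat.leb_spec j (l + tau)); [reflexivity|].
    rewrite HK in HKl by lia; discriminate. }
  replace (delay_gap d j) with (sumR j (fun l => window tau j l * a l)).
  2: { apply sumR_ext; intros l _; fold (a l); destruct (Ha l) as [-> | [-> _]]; ring. }
  eapply Rle_trans; [apply sumR_cauchy|].
  rewrite Rmult_assoc; apply Rmult_le_compat.
  - apply sumR_nonneg; intros; apply pow2_ge_0.
  - apply sumR_nonneg; intros; apply pow2_ge_0.
  - rewrite (sumR_ext j _ (window tau j)); [apply sumR_window|].
    intros l _; destruct (window_01 tau j l) as [-> | ->]; ring.
  - rewrite <- sumR_scal; apply sumR_le; intros l _.
    destruct (Ha l) as [-> | [-> ->]]; [|apply Req_le; ring].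
    assert (0 <= beta^2 * ((gam d l)^2 * (A (d j) (d l))^2)).
    { rewrite <- !Rpow_mult_distr; apply pow2_ge_0. }
    destruct (window_01 tau j l) as [-> | ->]; nra.
Qed.

Definition window_sum (g : nat -> R) (j : nat) : R := sumR j (fun l => window tau j l * g l).

(** d_j is independent of gamma_l and d_l. Averaging over d_j alone turns the squared entry into the
    mean square of row d_l, which [rho2] bounds. *)
Lemma avg_gam_A_sq j l : (l < j)%nat ->
  avg n (S j) (fun d => (gam d l)^2 * (A (d j) (d l))^2) <= rho2 n A * gamsq l.
Proof.
  intros Hl; rewrite (avg_resample n (S j) j) by (assumption || lia).
  rewrite <- (gamsq_horizon l (S j)), <- avg_scal by lia.
  apply avg_le; [assumption|]; intros d Hd.
  rewrite (mean_ext n _ (fun k => (gam d l)^2 * (A (d l) k)^2)).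
  - unfold mean; rewrite sumR_scal, (Rmult_comm (rho2 n A)); unfold Rdiv; rewrite Rmult_assoc.
    apply Rmult_le_compat_l; [apply pow2_ge_0|]; rewrite Rmult_comm.
    apply (maxR_ge n (fun l => / INR n * sumR n (fun r => (A l r)^2))), Hd.
  - intros k Hk; rewrite (gam_ext (upd d j k) d), upd_same, upd_diff by
      (lia || (intros; apply upd_diff; lia)).
    now rewrite (Hsym k (d l)) by (assumption || apply Hd).
Qed.

Lemma avg_delay_gap_sq j :
  avg n (S j) (fun d => (delay_gap d j)^2)
  <= beta^2 * INR tau * rho2 n A * window_sum gamsq j.
Proof.
  eapply Rle_trans; [apply avg_le; [assumption|]; intros d _; apply delay_gap_sq|].
  rewrite avg_scal, avg_sumR by assumption.
  replace (beta^2 * INR tau * rho2 n A * window_sum gamsq j)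
    with (INR tau * beta^2 * (rho2 n A * window_sum gamsq j)) by ring.
  apply Rmult_le_compat_l.
  { apply Rmult_le_pos; [apply pos_INR|apply pow2_ge_0]. }
  unfold window_sum; rewrite <- sumR_scal; apply sumR_le; intros l Hl; rewrite avg_scal.
  assert (H := avg_gam_A_sq j l Hl).
  destruct (window_01 tau j l) as [-> | ->]; lra.
Qed.

(** With D the delay gap, the residual is -gamma + D, and the cross term is split by 2 beta gamma D
    <= beta^2 gamma^2 + D^2. With these weights, tau charges of size beta^2 tau rho2 leave exactly
    [omega] of the coefficient 2 beta - 2 beta^2. *)
Lemma errsq_decrease j :
  errsq full (S j) <= errsq full j - (2 * beta - 2 * beta^2) * gamsq j
                      + beta^2 * INR tau * rho2 n A * window_sum gamsq j.
Proof.
  apply Rle_trans with (avg n (S j) (fun d => Anorm2 n A (err full d j)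
    + ((-(2 * beta - 2 * beta^2)) * (gam d j)^2 + (delay_gap d j)^2))).
  - apply avg_le; [assumption|]; intros d Hd; rewrite <- Nat.add_1_r.
    rewrite Anorm2_err_S, residual_gap by assumption; unfold full at 1.
    assert (0 <= (beta * gam d j - delay_gap d j)^2) by apply pow2_ge_0; nra.
  - rewrite !avg_plus, avg_scal, errsq_horizon, gamsq_horizon by lia.
    assert (H := avg_delay_gap_sq j); lra.
Qed.

(** Weighted Young inequality for gamma = D - u; the weight t stays free until the recursion over
    the window fixes it. *)
Lemma gamsq_le j t : 0 < t < 1 ->
  gamsq j <= lmax / INR n * errsq full j / (1 - t)
             + beta^2 * INR tau * rho2 n A * window_sum gamsq j / t.
Proof.
  intros Ht.
  apply Rle_trans with (avg n (S j) (fun d => / (1 - t) * (mulv n A (err full d j) (d j))^2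
    + / t * (delay_gap d j)^2)).
  - apply avg_le; [assumption|]; intros d Hd.
    set (u := mulv n A (err full d j) (d j)).
    replace (gam d j) with (delay_gap d j - u)
      by (unfold u; rewrite residual_gap by assumption; ring).
    set (D := delay_gap d j).
    replace (/ (1 - t) * u^2 + / t * D^2)
      with ((D - u)^2 + (t * u + (1 - t) * D)^2 * / (t * (1 - t))) by (field; lra).
    assert (0 <= (t * u + (1 - t) * D)^2 * / (t * (1 - t))); [|lra].
    apply Rmult_le_pos; [apply pow2_ge_0|left; apply Rinv_0_lt_compat; nra].
  - rewrite avg_plus, !avg_scal, (Rmult_comm (/ (1 - t))), (Rmult_comm (/ t)).
    apply Rplus_le_compat; apply Rmult_le_compat_r;
      try (left; apply Rinv_0_lt_compat; lra).
    + assert (H := avg_residual_sq_le full j); rewrite Nat.add_1_r in H; exact H.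
    + apply avg_delay_gap_sq.
Qed.

End Iteration.

(** * Lyapunov function *)

(* Each read error g_i is charged to the iterations j with j - tau <= i < j; at time s,
   i + tau + 1 - s (truncated subtraction) of these charges are still to come. *)
Definition pending (tau : nat) (g : nat -> R) (s : nat) : R :=
  sumR s (fun i => INR (i + tau + 1 - s) * g i).

(** Passing time s, every index in the window pays one charge and the new index s brings tau of
    them. *)
Lemma pending_S tau g s :
  pending tau g (S s) = pending tau g s - window_sum tau g s + INR tau * g s.
Proof.
  unfold pending, window_sum; cbn [sumR].
  replace (s + tau + 1 - S s)%nat with tau by lia.
  rewrite (sumR_ext s (fun i => INR (i + tau + 1 - s) * g i)
    (fun i => INR (i + tau + 1 - S s) * g i + window tau s i * g i)).
  - rewrite sumR_plus; ring.
  - intros i Hi; unfold window; destruct (Nat.leb_spec s (i + tau)).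
    + replace (i + tau + 1 - s)%nat with (S (i + tau + 1 - S s)) by lia; rewrite S_INR; ring.
    + replace (i + tau + 1 - s)%nat with O by lia.
      replace (i + tau + 1 - S s)%nat with O by lia; simpl; ring.
Qed.

Lemma pending_nonneg tau g s : (forall i, 0 <= g i) -> 0 <= pending tau g s.
Proof.
  intros Hg; apply sumR_nonneg; intros; apply Rmult_le_pos; [apply pos_INR|auto].
Qed.

Lemma window_sum_le tau g s b : 0 <= b ->
  (forall i, (i < s)%nat -> (s <= i + tau)%nat -> g i <= b) ->
  window_sum tau g s <= INR tau * b.
Proof.
  intros Hb Hg; apply Rle_trans with (sumR s (fun i => b * window tau s i)).
  - apply sumR_le; intros i Hi; unfold window; destruct (Nat.leb_spec s (i + tau)); [|lra].
    specialize (Hg i); assert (g i <= b) by auto; lra.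
  - rewrite sumR_scal, Rmult_comm; apply Rmult_le_compat_r; [assumption|apply sumR_window].
Qed.

Lemma pending_le_window_sum tau g s : (forall i, 0 <= g i) ->
  pending tau g s <= INR tau * window_sum tau g s.
Proof.
  intros Hg; unfold pending, window_sum; rewrite <- sumR_scal; apply sumR_le; intros i Hi.
  specialize (Hg i); unfold window; destruct (Nat.leb_spec s (i + tau)).
  - rewrite Rmult_1_l; apply Rmult_le_compat_r; [assumption|apply le_INR; lia].
  - replace (i + tau + 1 - s)%nat with O by lia; simpl; lra.
Qed.

(** Each g_j is prepaid with C tau on entry; the later payments cancel the window sums, so only a -
    C tau is left. *)
Lemma lyapunov_decrease (E g : nat -> R) tau a C s k :
  (forall j, E (S j) <= E j - a * g j + C * window_sum tau g j) ->
  E (s + k)%nat + C * pending tau g (s + k) <=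
  E s + C * pending tau g s - (a - C * INR tau) * sumR k (fun i => g (s + i)%nat).
Proof.
  intros HE; induction k as [|k IH]; [rewrite Nat.add_0_r; simpl; lra|].
  rewrite Nat.add_succ_r, pending_S; cbn [sumR]; specialize (HE (s + k)%nat); lra.
Qed.

(* Here lam E_j bounds the exact-read value of g_j; when D tau^2 P = t^2 < 1 the delays
   inflate it by at most a constant. *)
Lemma delayed_bound (E g : nat -> R) tau lam D P t :
  0 <= lam -> 0 <= D -> 0 <= P -> 0 < t < 1 -> D * INR tau * P = t^2 -> (forall j, 0 <= E j) ->
  (forall i j, (i < j)%nat -> (j <= i + tau)%nat -> E i <= P * E j) ->
  (forall j, g j <= lam * E j / (1 - t) + D * window_sum tau g j / t) ->
  forall j, g j <= lam * E j / (1 - t)^2.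
Proof.
  intros Hlam HD HP0 Ht HDP HE HP Hg.
  assert (Hc : 0 < / (1 - t)^2) by (apply Rinv_0_lt_compat; nra).
  induction j as [j IH] using (well_founded_induction Wf_nat.lt_wf).
  assert (HPE : D * window_sum tau g j <= D * (INR tau * (lam * (P * E j) / (1 - t)^2))).
  { apply Rmult_le_compat_l; [assumption|]; apply window_sum_le.
    - repeat apply Rmult_le_pos; auto; lra.
    - intros i Hi Hji; eapply Rle_trans; [apply IH, Hi|].
      apply Rmult_le_compat_r; [lra|]; apply Rmult_le_compat_l; auto. }
  eapply Rle_trans; [apply Hg|].
  apply Rle_trans with
    (lam * E j / (1 - t) + D * (INR tau * (lam * (P * E j) / (1 - t)^2)) / t).
  - apply Rplus_le_compat_l, Rmult_le_compat_r; [left; apply Rinv_0_lt_compat; lra|exact HPE].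
  (* The bound is the fixed point of the recursion: as D tau P = t^2, the two terms are the
     fractions 1 - t and t of it. *)
  - apply Req_le.
    replace (D * (INR tau * (lam * (P * E j) / (1 - t)^2)) / t)
      with ((D * INR tau * P) * (lam * E j / (1 - t)^2) / t) by (field; lra).
    rewrite HDP; field; lra.
Qed.

(* In the application Z = rho2 tau^2, P = (1 - lam)^(-tau), y = tau lam, a is the guaranteed
   decrease per block and Z y beta^2 P^2 is psi. *)
Lemma block_margin beta Z P y a t :
  0 < beta < 1 -> 0 <= Z -> 1 <= P -> 1 - / P <= y -> 0 <= t -> t^2 = beta^2 * Z * P ->
  a * P <= beta * (1 - beta - Z * beta / 2) -> Z * y * beta^2 * P^2 < a ->
  t < 1 /\ a - Z * y * beta^2 * P^2 <= (1 - t)^2.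
Proof.
  intros Hb HZ HP Hy Ht Ht2 Ha Hlt; set (p := Z * y * beta^2 * P^2) in *.
  assert (Hb2 : 0 <= beta^2 * Z) by nra.
  assert (HyP : P - 1 <= y * P^3).
  { assert (P - 1 <= y * P).
    { replace (P - 1) with ((1 - / P) * P) by (field; lra). apply Rmult_le_compat_r; lra. }
    assert (0 <= (y * P) * (P^2 - 1)) by (apply Rmult_le_pos; nra). nra. }
  assert (Hp : beta^2 * Z * (P - 1) <= p * P).
  { unfold p; replace (Z * y * beta^2 * P^2 * P) with (beta^2 * Z * (y * P^3)) by ring.
    now apply Rmult_le_compat_l. }
  (* The hypothesis on a P involves Z, but t^2 involves Z P; the term p P makes up for this
     difference. *)
  assert (H : (a - p) * P <= beta * (1 - beta) - t^2 / 2).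
  { rewrite Ht2; assert (0 <= beta^2 * Z * (P - 1)) by (apply Rmult_le_pos; lra); nra. }
  assert (Hb4 : beta * (1 - beta) <= / 4)
    by (assert (0 <= (beta - / 2)^2) by apply pow2_ge_0; lra).
  assert (Hap : a - p <= (a - p) * P).
  { assert (0 <= (a - p) * (P - 1)) by (apply Rmult_le_pos; lra). lra. }
  split.
  - assert (Ht1 : t^2 < 1) by lra; clear - Ht1 Ht; nra.
  (* (1 - t)^2 - (1/4 - t^2/2) is a quadratic in t with minimum 1/12 at t = 2/3. *)
  - assert (0 <= (t - 2 / 3)^2) by apply pow2_ge_0; lra.
Qed.

(** * Powers and geometric sums *)

Lemma bernoulli lam k : 0 <= lam <= 1 -> 1 - INR k * lam <= (1 - lam)^k.
Proof.
  intros H; induction k as [|k IH]; [simpl; lra|].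
  rewrite S_INR; cbn [pow].
  assert (0 <= INR k) by apply pos_INR. nra.
Qed.

Lemma geometric_sum lam k : lam * sumR k (pow (1 - lam)) = 1 - (1 - lam)^k.
Proof. induction k as [|k IH]; simpl; [ring|]. rewrite Rmult_plus_distr_l, IH; ring. Qed.

Lemma pow_le_half x k : 0 < x < 1 -> INR k >= ln (1 / 2) / ln x -> x^k <= 1 / 2.
Proof.
  intros Hx Hk.
  assert (Hln : ln x < 0) by (rewrite <- ln_1; apply ln_increasing; lra).
  rewrite <- Rpower_pow by lra; unfold Rpower.
  rewrite <- (exp_ln (1 / 2)) by lra.
  assert (H : INR k * ln x <= ln (1 / 2)).
  { replace (ln (1 / 2)) with (ln (1 / 2) / ln x * ln x) by (field; lra). nra. }
  destruct H as [H|H]; [left; now apply exp_increasing|rewrite H; lra].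
Qed.

Theorem theorem3 (n : nat) (A : nat -> nat -> R) (b xs x0 : nat -> R)
  (lmin lmax beta : R) (tau : nat) (K : nat -> nat -> bool) (T0 : nat) :
  (2 <= n)%nat ->
  (forall i j, (i < n)%nat -> (j < n)%nat -> A i j = A j i) ->
  (forall i, (i < n)%nat -> A i i = 1) ->
  (forall x : nat -> R, (exists i, (i < n)%nat /\ x i <> 0) -> Ainner n A x x > 0) ->
  (forall i, (i < n)%nat -> sumR n (fun j => A i j * xs j) = b i) ->
  is_min_eigenvalue n A lmin ->
  is_max_eigenvalue n A lmax ->
  (forall j i, (i + tau + 1 <= j)%nat -> K j i = true) ->
  (forall j i, K j i = true -> (i < j)%nat) ->
  0 <= beta < 1 ->
  omega (rho2 n A) (INR tau) beta > 0 ->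
  let kappa := lmax / lmin in
  let q := ln (1/2) / ln (1 - lmax / INR n) in
  let w := omega (rho2 n A) (INR tau) beta in
  let E := Eerr n A xs x0 beta K in
  (* T0 = ceiling of q *)
  INR T0 - 1 < q <= INR T0 ->
  (forall m : nat, INR m >= q -> E m <= (1 - w / (2 * kappa)) * E O) /\
  (let T := (T0 + tau)%nat in
   let psi := rho2 n A * INR tau ^ 3 * beta ^ 2 * lmax
              / (1 - lmax / INR n) ^ (2 * tau) / INR n in
   forall r m : nat, (1 <= r)%nat -> (r * T <= m)%nat ->
     E m <= (1 - w / (2 * kappa))
            * (1 - w * (1 - lmax / INR n) ^ tau / (2 * kappa) + psi) ^ (r - 1)
            * E O).
Proof.
  intros Hn2 Hsym Hdiag Hpd _ Hmin Hmax HK _ Hb01 Hw kappa q w E HT0.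
  assert (Hn : (0 < n)%nat) by lia.
  assert (HnR : 0 < INR n) by (apply lt_0_INR; lia).
  assert (Hlmin : 0 < lmin) by (apply (eigenvalue_pos n A); [exact Hpd|apply Hmin]).
  assert (Hlm : lmin <= lmax) by (apply Hmin, Hmax).
  assert (Hlt : lmax < INR n) by now apply (max_eigenvalue_lt n A).
  set (lam := lmax / INR n) in *.
  assert (Hlam : 0 < lam < 1).
  { unfold lam; split; [apply Rdiv_lt_0_compat; lra|].
    apply Rmult_lt_reg_r with (INR n); [assumption|].
    unfold Rdiv; rewrite Rmult_assoc, Rinv_l by lra; lra. }
  assert (Hkappa : 1 <= kappa).
  { unfold kappa; apply Rmult_le_reg_r with lmin; [assumption|].
    unfold Rdiv; rewrite Rmult_assoc, Rinv_l by lra; lra. }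
  assert (Hrho : 0 <= rho2 n A).
  { eapply Rle_trans; [|apply (maxR_ge n _ 0%nat Hn)].
    apply Rmult_le_pos; [left; now apply Rinv_0_lt_compat|].
    apply sumR_nonneg; intros; apply pow2_ge_0. }
  assert (Htau := pos_INR tau).
  set (Z := rho2 n A * INR tau^2).
  assert (HZ : 0 <= Z) by (apply Rmult_le_pos; [assumption|apply pow2_ge_0]).
  assert (Hw2 : w = 2 * beta * (1 - beta - Z * beta / 2)) by reflexivity.
  assert (Hwpos : 0 < w) by exact Hw.
  assert (Hb : 0 < beta < 1) by (destruct Hb01 as [[H|H] H']; [lra|rewrite <- H in Hw2; lra]).
  assert (Hw1 : w <= 1 / 2).
  { assert (0 <= (beta - / 2)^2) by apply pow2_ge_0.
    assert (0 <= Z * beta^2) by (apply Rmult_le_pos; [assumption|apply pow2_ge_0]).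
    rewrite Hw2; lra. }
  set (e := errsq n A xs x0 beta K full).
  set (g := gamsq n A xs x0 beta K).
  assert (HE : forall m, E m = e m) by (intros; now apply errsq_Eerr).
  assert (He : forall m, 0 <= e m) by (intros; now apply errsq_nonneg).
  assert (Hg : forall j, 0 <= g j) by (intros; now apply gamsq_nonneg).
  set (C := beta^2 * INR tau * rho2 n A).
  assert (HC : 0 <= C) by (repeat apply Rmult_le_pos; lra).
  set (L := fun s => e s + C * pending tau g s).
  assert (HeL : forall s, e s <= L s).
  { intros s; unfold L; assert (0 <= C * pending tau g s); [|lra].
    apply Rmult_le_pos; [assumption|now apply pending_nonneg]. }
  assert (HL : forall s k, L (s + k)%nat <= L s - w * sumR k (fun i => g (s + i)%nat)).
  { intros s k; replace w with ((2 * beta - 2 * beta^2) - C * INR tau)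
      by (rewrite Hw2; unfold C, Z; field).
    apply lyapunov_decrease; intros j; now apply errsq_decrease. }
  assert (HLmono : forall s m, (s <= m)%nat -> L m <= L s).
  { intros s m Hsm; replace m with (s + (m - s))%nat by lia.
    eapply Rle_trans; [apply HL|].
    assert (0 <= sumR (m - s) (fun i => g (s + i)%nat)) by (apply sumR_nonneg; auto). nra. }
  assert (HL0 : L O = e O) by (unfold L, pending; simpl; ring).
  (* Once (1 - lam)^k <= 1/2 the geometric sum is at least 1/(2 lam), and lmin/n times this is 1/(2
     kappa). *)
  assert (Hgeo : forall k, INR k >= q ->
    / (2 * kappa) <= lmin / INR n * sumR k (pow (1 - lam))).
  { intros k Hk; assert (H := geometric_sum lam k).
    assert (H' := pow_le_half (1 - lam) k ltac:(lra) Hk).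
    replace (/ (2 * kappa)) with (lmin / INR n * (1 / (2 * lam)))
      by (unfold kappa, lam; field; lra).
    apply Rmult_le_compat_l; [apply Rlt_le, Rdiv_lt_0_compat; lra|].
    apply Rmult_le_reg_l with lam; [lra|]; rewrite H.
    replace (lam * (1 / (2 * lam))) with (1 / 2) by (field; lra); lra. }
  assert (Ha : forall m, INR m >= q -> L m <= (1 - w / (2 * kappa)) * e O).
  { intros m Hm; assert (H := HL O m); rewrite HL0 in H; cbn [Nat.add] in H.
    change (sumR m (fun i => g i)) with (sumR m g) in H.
    assert (Hs : / (2 * kappa) * e O <= sumR m g).
    { apply Rle_trans with (sumR m (fun i => lmin / INR n * e O * (1 - lam)^i)).
      - rewrite sumR_scal, (Rmult_comm (/ _)).
        replace (lmin / INR n * e O * sumR m (pow (1 - lam)))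
          with (e O * (lmin / INR n * sumR m (pow (1 - lam)))) by ring.
        apply Rmult_le_compat_l; auto.
      - apply sumR_le; intros i _.
        eapply Rle_trans; [|apply (gamsq_ge n A xs x0 lmin beta K); assumption].
        rewrite Rmult_assoc; apply Rmult_le_compat_l; [apply Rlt_le, Rdiv_lt_0_compat; lra|].
        (* At time 0 no update has been applied, so the partial error for K(i) is the initial error
           and no delay is lost. *)
        rewrite Rmult_comm; change (e O) with (errsq n A xs x0 beta K (K i) O).
        now apply (errsq_steps n A xs x0 lmax beta K) with (t := O). }
    apply Rmult_le_compat_l with (r := w) in Hs; [|lra].
    replace ((1 - w / (2 * kappa)) * e O) with (e O - w * (/ (2 * kappa) * e O)) by (field; lra).
    lra. }
  assert (Hq : INR T0 >= q) by lra.
  split.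
  { intros m Hm; rewrite !HE; eapply Rle_trans; [apply HeL|now apply Ha]. }
  intros T psi r m Hr Hm; rewrite !HE.
  set (P := / (1 - lam)^tau).
  assert (Hs : 0 < (1 - lam)^tau) by (apply pow_lt; lra).
  assert (HPs : / P = (1 - lam)^tau) by (unfold P; now rewrite Rinv_inv).
  assert (Hpow1 : forall k, (1 - lam)^k <= 1).
  { intros k; apply Rle_trans with (1^k); [apply pow_incr|rewrite pow1]; lra. }
  assert (HP1 : 1 <= P).
  { unfold P; rewrite <- Rinv_1 at 1; apply Rinv_le_contravar; auto. }
  set (y := INR tau * lam).
  assert (Hpsi : psi = Z * y * beta^2 * P^2).
  { unfold psi, Z, y, P; rewrite (Nat.mul_comm 2), pow_mult.
    set (sg := (1 - lam)^tau) in *; unfold lam; field; lra. }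
  assert (HZy : 0 <= Z * y * beta^2).
  { apply Rmult_le_pos; [|apply pow2_ge_0].
    apply Rmult_le_pos; [assumption|apply Rmult_le_pos; lra]. }
  assert (Hpsi0 : 0 <= psi) by (rewrite Hpsi; apply Rmult_le_pos; [assumption|apply pow2_ge_0]).
  set (a := w * (1 - lam)^tau / (2 * kappa)).
  assert (Hback : forall i j, (i < j)%nat -> (j <= i + tau)%nat -> e i <= P * e j).
  { intros i j Hij Hji.
    assert (H := errsq_steps n A xs x0 lmax beta K Hn Hsym Hpd Hdiag Hmax full i (j - i) Hlt).
    replace (i + (j - i))%nat with j in H by lia; fold e lam in H.
    assert (H' : (1 - lam)^tau * e i <= e j).
    { eapply Rle_trans; [|apply H]; apply Rmult_le_compat_r; [apply He|].
      replace tau with ((j - i) + (tau - (j - i)))%nat by lia; rewrite pow_add.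
      assert (0 < (1 - lam)^(j - i)) by (apply pow_lt; lra).
      specialize (Hpow1 (tau - (j - i))%nat); nra. }
    apply Rmult_le_reg_l with (/ P); [rewrite HPs; assumption|].
    rewrite <- Rmult_assoc, Rinv_l, HPs by lra; lra. }
  assert (HaP : a * P <= beta * (1 - beta - Z * beta / 2)).
  { unfold a, P.
    replace (w * (1 - lam)^tau / (2 * kappa) * / (1 - lam)^tau) with (w / 2 * / kappa)
      by (field; lra).
    assert (/ kappa <= 1) by (rewrite <- Rinv_1; apply Rinv_le_contravar; lra).
    apply Rle_trans with (w / 2 * 1); [apply Rmult_le_compat_l; lra|lra]. }
  assert (Ha0 : 0 < a) by (apply Rdiv_lt_0_compat; [now apply Rmult_lt_0_compat|lra]).
  assert (Habsorb : forall s, (a - psi) * (C * pending tau g s) <= psi * e s).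
  { intros s.
    assert (HX : 0 <= C * pending tau g s)
      by (apply Rmult_le_pos; [assumption|now apply pending_nonneg]).
    assert (Hpe : 0 <= psi * e s) by (apply Rmult_le_pos; auto).
    destruct (Rle_lt_dec a psi) as [Hle|Hlt']; [nra|].
    (* If C = 0 there are no charges; this case is split off because t below must be positive. *)
    destruct HC as [HC|HC]; [|rewrite <- HC; lra].
    assert (HtauP : 0 < INR tau).
    { destruct Htau as [H|H]; [exact H|unfold C in HC; rewrite <- H in HC; lra]. }
    (* Chosen so that C tau P = t^2, as [delayed_bound] demands. *)
    set (t := sqrt (beta^2 * Z * P)).
    assert (Ht2pos : 0 < beta^2 * Z * P).
    { replace (beta^2 * Z * P) with (C * INR tau * P) by (unfold C, Z; ring).
      apply Rmult_lt_0_compat; [now apply Rmult_lt_0_compat|lra]. }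
    assert (Ht0 : 0 < t) by now apply sqrt_lt_R0.
    assert (Ht2 : t^2 = beta^2 * Z * P) by (unfold t; rewrite pow2_sqrt; lra).
    destruct (block_margin beta Z P y a t) as [Ht1 Hmargin]; try assumption; try lra.
    { rewrite HPs; unfold y; assert (H := bernoulli lam tau); lra. }
    rewrite <- Hpsi in Hmargin.
    assert (Hgb : forall j, g j <= lam * e j / (1 - t)^2).
    { apply (delayed_bound e g tau lam C P t); try assumption; try lra.
      - rewrite Ht2; unfold C, Z; ring.
      - intros j; now apply gamsq_le. }
    assert (H1t : 0 < (1 - t)^2) by nra.
    assert (Hpend : pending tau g s <= INR tau * (INR tau * (lam * (P * e s) / (1 - t)^2))).
    { eapply Rle_trans; [now apply pending_le_window_sum|].
      apply Rmult_le_compat_l; [lra|]; apply window_sum_le.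
      - apply Rmult_le_pos; [|left; now apply Rinv_0_lt_compat].
        apply Rmult_le_pos; [lra|]; apply Rmult_le_pos; [lra|auto].
      - intros i Hi Hsi; eapply Rle_trans; [apply Hgb|].
        apply Rmult_le_compat_r; [left; now apply Rinv_0_lt_compat|].
        apply Rmult_le_compat_l; [lra|auto]. }
    apply Rle_trans with ((1 - t)^2 *
      (C * (INR tau * (INR tau * (lam * (P * e s) / (1 - t)^2))))).
    { apply Rmult_le_compat; try lra. apply Rmult_le_compat_l; lra. }
    replace ((1 - t)^2 * (C * (INR tau * (INR tau * (lam * (P * e s) / (1 - t)^2)))))
      with (Z * y * beta^2 * P * e s) by (unfold C, Z, y; field; lra).
    (* The estimate has produced P where psi contains P^2, and P >= 1. *)
    rewrite Hpsi; apply Rmult_le_compat_r; [apply He|].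
    apply Rmult_le_compat_l; nra. }
  assert (Hblock : forall s, L (s + T)%nat <= (1 - a + psi) * L s).
  { intros s; apply Rle_trans with (L s - a * e s).
    - eapply Rle_trans; [apply HL|].
      assert (Hsum : a / w * e s <= sumR T (fun i => g (s + i)%nat)).
      (* The first tau terms of the block are dropped; from s + tau on, every read contains all
         updates made before s. *)
      { unfold T; rewrite Nat.add_comm, sumR_add.
        assert (0 <= sumR tau (fun i => g (s + i)%nat)) by (apply sumR_nonneg; auto).
        apply Rle_trans with (sumR T0 (fun i => g (s + (tau + i))%nat)); [|lra].
        apply Rle_trans with
          (sumR T0 (fun i => (lmin / INR n * (1 - lam)^tau * e s) * (1 - lam)^i)).
        - rewrite sumR_scal; specialize (Hgeo T0 Hq).
          replace (a / w * e s) with ((1 - lam)^tau * e s * / (2 * kappa))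
            by (unfold a; field; lra).
          replace (lmin / INR n * (1 - lam)^tau * e s * sumR T0 (pow (1 - lam)))
            with ((1 - lam)^tau * e s * (lmin / INR n * sumR T0 (pow (1 - lam)))) by ring.
          apply Rmult_le_compat_l; [|assumption]. apply Rmult_le_pos; [lra|auto].
        - apply sumR_le; intros i _.
          eapply Rle_trans; [|apply (gamsq_ge n A xs x0 lmin beta K); assumption].
          replace (lmin / INR n * (1 - lam)^tau * e s * (1 - lam)^i)
            with (lmin / INR n * ((1 - lam)^(tau + i) * e s)) by (rewrite pow_add; ring).
          apply Rmult_le_compat_l; [apply Rlt_le, Rdiv_lt_0_compat; lra|].
          apply (errsq_read n A xs x0 lmax beta tau K); try assumption; lia. }
      apply Rmult_le_compat_l with (r := w) in Hsum; [|lra].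
      replace (w * (a / w * e s)) with (a * e s) in Hsum by (field; lra). lra.
    - specialize (Habsorb s); unfold L; nra. }
  (* Allows the induction over blocks to multiply by this rate; a <= a P <= w/2 <= 1/4. *)
  assert (Hf : 0 <= 1 - a + psi).
  { assert (a <= a * P) by nra.
    lra. }
  assert (Hind : forall k, L (S k * T)%nat <=
    (1 - w / (2 * kappa)) * (1 - a + psi)^k * e O).
  { induction k as [|k IH].
    (* T >= q, so the first block is covered by the bound of (a), which already holds for L and not
       only for E. *)
    - rewrite Nat.mul_1_l; simpl; rewrite Rmult_1_r; apply Ha.
      unfold T; rewrite plus_INR; lra.
    - replace (S (S k) * T)%nat with (S k * T + T)%nat by lia.
      eapply Rle_trans; [apply Hblock|].
      replace ((1 - w / (2 * kappa)) * (1 - a + psi)^S k * e O)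
        with ((1 - a + psi) * ((1 - w / (2 * kappa)) * (1 - a + psi)^k * e O))
        by (simpl; ring).
      now apply Rmult_le_compat_l. }
  eapply Rle_trans; [apply HeL|].
  eapply Rle_trans; [apply (HLmono (r * T)%nat), Hm|].
  replace r with (S (r - 1)) at 1 by lia; apply Hind.
Qed.
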